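(* For every integer $n\ge 1$, $$\mathrm{OCN}(K_{n,n}) = 4n\binom{n}{3}.$$ Moreover, this value is attained by the rectilinear drawing in which the $2n$ vertices are placed in convex position and the two colour classes (the two parts of $K_{n,n}$) alternate around the convex hull.
   Context: A finite set of points in $\mathbb{R}^2$ is a generic configuration if no three of its points are collinear. A line $L$ separates two points $P,Q\notin L$ if they lie in different connected components of $\mathbb{R}^2\setminus L$. For a generic configuration $\mathcal P$ and $P,Q\in\mathcal P$, let $n(P,Q)$ be the number of lines determined by pairs of points of $\mathcal P\setminus\{P,Q\}$ that separate $P$ and $Q$. A rectilinear drawing $R(G)$ of an abstract graph $G=(V,E)$ is a generic configuration $V'$ of points in $\mathbb{R}^2$ in bijection with $V$, where each edge is drawn as the straight segment between the corresponding points. Its crossing number is $n(R(G))=\sum_{(s,t)\in E} n(s',t')$, where $n(\cdot,\cdot)$ is computed with respect to the whole configuration $V'$ (all lines through pairs of points of $V'$ count, not only edges). The Orchard crossing number is $\mathrm{OCN}(G)=\min_{R(G)} n(R(G))$, the minimum over all rectilinear drawings of $G$. $K_{n,n}$ is the complete bipartite graph with two parts (colours, black and white) of $n$ vertices each. *)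

(* Defs.v *)
From HB Require Import structures.
From mathcomp Require Import all_boot all_order all_algebra.
From mathcomp Require Import finmap ring.
From mathcomp Require Import boolp classical_sets functions cardinality reals.
From mathcomp Require Import topology normedtype convex.

Set Implicit Arguments.
Unset Strict Implicit.
Unset Printing Implicit Defensive.

Import Order.TTheory GRing.Theory Num.Theory.
Import numFieldNormedType.Exports.

Local Open Scope classical_set_scope.
Local Open Scope ring_scope.

Section Plane.
Variable R : realType.
Local Notation plane := 'rV[R]_2.
Implicit Types (A B P Q : plane) (L C : set plane).

Definition line A B : set plane := range (fun t : R => A + t *: (B - A)).

Definition is_line L : Prop := exists A B, A <> B /\ L = line A B.

Definition collinear A B P : Prop := exists L, [/\ is_line L, L A, L B & L P].

Definition generic C : Prop :=
  finite_set C /\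
  forall A B P, C A -> C B -> C P -> A <> B -> A <> P -> B <> P ->
    ~ collinear A B P.

Definition separates L P Q : Prop :=
  [/\ ~ L P, ~ L Q &
      connected_component (~` L) P <> connected_component (~` L) Q].

Definition determined_lines C : set (set plane) :=
  [set L | exists A B, [/\ C A, C B, A <> B & L = line A B]].

(* [fset_set] sends infinite sets to the empty one; the set of lines below is
   finite whenever [C] is. *)
Definition nsep C P Q : nat :=
  #|` fset_set [set L | determined_lines (C `\` [set P; Q]) L /\
                        separates L P Q] |.

Definition hull C : set plane := smallest (@convex_set R plane) C.

Definition convex_position C : Prop :=
  forall P, C P -> ~ hull (C `\ P) P.

(* The segment [P, Q] is an edge, i.e. an exposed one-dimensional face, of the
   convex hull of C; [x *m a] is an arbitrary linear functional on the plane. *)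
Definition hull_edge C P Q : Prop :=
  P <> Q /\
  exists (a : 'cV[R]_2) (c : R),
    [/\ a != 0,
        (forall x, hull C x -> (x *m a) 0 0 <= c) &
        hull [set P; Q] = hull C `&` [set x | (x *m a) 0 0 = c]].

End Plane.

Record sgraph := SGraph {
  vertex :> finType;
  adj : rel vertex;
  adj_sym : symmetric adj;
  adj_irr : irreflexive adj }.

Section Drawings.
Variables (R : realType) (G : sgraph).

(* A drawing is given by the positions of the vertices; the edges, being
   straight segments, are determined by them. *)
Definition rectilinear_drawing (p : G -> 'rV[R]_2) : Prop :=
  injective p /\ generic (range p).

(* The condition on [enum_rank] makes every undirected edge count once. *)
Definition crossing_number (p : G -> 'rV[R]_2) : nat :=
  (\sum_(s : G) \sum_(t : G | (enum_rank s < enum_rank t) && adj s t)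
     nsep (range p) (p s) (p t))%N.

Lemma rectilinear_drawing_exists :
  exists p : G -> 'rV[R]_2, rectilinear_drawing p.
Proof.
pose r (v : G) : R := (enum_rank v)%:R.
pose p (v : G) : 'rV[R]_2 := \row_(j < 2) (r v ^+ j.+1).
have p0 v : p v 0 0 = r v by rewrite mxE expr1.
have p1 v : p v 0 1 = r v ^+ 2 by rewrite mxE.
have rI : injective r.
  by move=> u v /eqP; rewrite eqr_nat => /eqP/val_inj/enum_rank_inj.
exists p; split; first by move=> u v /(congr1 (fun x : 'rV_2 => x 0 0)); rewrite !p0 => /rI.
split; first exact/finite_image/finite_finset.
move=> _ _ _ [u _ <-] [v _ <-] [w _ <-] uv uw vw [_ [[A [B [_ ->]]]]].
move=> [a _ ea] [b _ eb] [c _ ec].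
have E x t : A + t *: (B - A) = p x ->
    r x = A 0 0 + t * (B 0 0 - A 0 0) /\
    r x ^+ 2 = A 0 1 + t * (B 0 1 - A 0 1).
  by move=> e; rewrite -p1 -p0 -e !mxE.
have [u0 u1] := E _ _ ea; have [v0 v1] := E _ _ eb; have [w0 w1] := E _ _ ec.
have : (r v - r u) * (r w - r u) * (r w - r v) = 0.
  have -> : (r v - r u) * (r w - r u) * (r w - r v) =
    (r v - r u) * (r w ^+ 2 - r u ^+ 2) - (r w - r u) * (r v ^+ 2 - r u ^+ 2).
    by ring.
  by rewrite u1 v1 w1 u0 v0 w0; ring.
move=> /eqP; rewrite !mulf_eq0 !subr_eq0 -orbA.
by case/or3P => /eqP/rI e; [apply: uv|apply: uw|apply: vw]; rewrite e.
Qed.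

Lemma crossing_number_exists :
  exists k : nat,
    `[< exists p, rectilinear_drawing p /\ crossing_number p = k >].
Proof.
have [p hp] := rectilinear_drawing_exists.
by exists (crossing_number p); apply/asboolP; exists p.
Qed.

Definition OCN : nat := ex_minn crossing_number_exists.

End Drawings.

Section CompleteBipartite.
Variable n : nat.

Definition is_black (v : 'I_n + 'I_n) : bool := if v is inl _ then true else false.

Definition Knn_adj : rel ('I_n + 'I_n) := fun u v => is_black u != is_black v.

Lemma Knn_adj_sym : symmetric Knn_adj.
Proof. by move=> u v; rewrite /Knn_adj eq_sym. Qed.

Lemma Knn_adj_irr : irreflexive Knn_adj.
Proof. by move=> u; rewrite /Knn_adj eqxx. Qed.

Definition Knn : sgraph := SGraph Knn_adj_sym Knn_adj_irr.

(* Consecutive vertices around the convex hull have different colours. *)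
Definition colours_alternate (R : realType) (p : Knn -> 'rV[R]_2) : Prop :=
  forall u v : Knn, hull_edge (range p) (p u) (p v) -> is_black u != is_black v.

End CompleteBipartite.

Definition alternating_convex_drawing (R : realType) (n : nat)
    (p : Knn n -> 'rV[R]_2) : Prop :=
  [/\ rectilinear_drawing p, convex_position (range p) & colours_alternate p].

(* Main.v *)
Require Import Defs.
From mathcomp Require Import all_boot all_order all_algebra reals.
From mathcomp Require Import finmap ring lra zify interval_inference.
From mathcomp Require Import boolp classical_sets functions cardinality.
From mathcomp Require Import topology normedtype convex.

(** Let [sg] be the colour sign (black [1], white [-1]) and, for a line [x y],
let [s u] in {-1, 0, 1} be the side of [u], and [excess x y] the sum of all
[sg u * s u].  Expanding [(1 - sg c * sg d) (s c ^ 2 * s d ^ 2 - s c * s d)]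
over ordered quadruples [x, y, c, d] gives, with [S] the number of ordered
quadruples whose first two points span a line separating the last two,
  [16 * crossing_number + 8 n (n - 1) = 2 S + sum of the excess x y ^ 2].
Any four points contribute to [S] at least two of their six splittings into a
line and a pair, so [6 S >= 2 * (2n)(2n-1)(2n-2)(2n-3)], and dropping the
squares gives the lower bound.  In convex position a quadruple contributes
exactly two.  If moreover the colours alternate, cutting the chain of points to
the left of [x y] down to hull edges shows that their signs sum up to
[- (sg x + sg y) / 2]; this is symmetric in [x] and [y], so all the excesses
vanish.  Points of a parabola with alternating colours realise this case. *)

Set Implicit Arguments.
Unset Strict Implicit.
Unset Printing Implicit Defensive.

Import Order.TTheory GRing.Theory Num.Theory.
Import numFieldNormedType.Exports.

Local Open Scope classical_set_scope.
Local Open Scope ring_scope.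

(** * Lines and convex hulls in the plane *)

Section Geometry.
Variable R : realType.
Local Notation plane := 'rV[R]_2.
Implicit Types (A B P Q : plane) (C : set plane).

(** Twice the signed area of the triangle [A B P], positive when [P] lies to the left of the line
    directed from [A] to [B]. *)
Definition orient A B P : R :=
  (B 0 0 - A 0 0) * (P 0 1 - A 0 1) - (B 0 1 - A 0 1) * (P 0 0 - A 0 0).

Lemma plane_eqP P Q : P 0 0 = Q 0 0 -> P 0 1 = Q 0 1 -> P = Q.
Proof.
move=> e0 e1; apply/rowP => i; case: i => [[|[|//]] lt_i].
  by rewrite (_ : Ordinal lt_i = 0) //; apply: val_inj.
by rewrite (_ : Ordinal lt_i = 1) //; apply: val_inj.
Qed.

Lemma lineP A B P : A <> B -> line A B P <-> orient A B P = 0.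
Proof.
move=> AB; split=> [[t _ <-]|o0]; first by rewrite /orient !mxE; ring.
(* The parameter is read off a coordinate in which [A] and [B] differ; a vertical line needs the
   second one. *)
have [e0|n0] := eqVneq (B 0 0) (A 0 0); last first.
  exists ((P 0 0 - A 0 0) / (B 0 0 - A 0 0)) => //.
  have n0' : B 0 0 - A 0 0 != 0 by rewrite subr_eq0.
  apply: plane_eqP; rewrite !mxE; first by field.
  apply: (mulfI n0'); rewrite mulrDr mulrA mulrCA divff // mulr1.
  by move: o0; rewrite /orient; lra.
have n1' : B 0 1 - A 0 1 != 0.
  by rewrite subr_eq0; apply/eqP => e1; apply: AB; apply: plane_eqP.
exists ((P 0 1 - A 0 1) / (B 0 1 - A 0 1)) => //.
apply: plane_eqP; rewrite !mxE; last by field.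
apply: (mulfI n1'); rewrite mulrDr mulrA mulrCA divff // mulr1.
by move: o0; rewrite /orient; lra.
Qed.

Lemma orient_continuous A B : continuous (orient A B).
Proof.
move=> P.
have c (i : 'I_2) : (fun X : plane => X 0 i - A 0 i) @ P --> P 0 i - A 0 i.
  exact: (cvgB (@coord_continuous R 1 2 0 i P) (cvg_cst _)).
by exact: (cvgB (cvgM (cvg_cst _) (c 1)) (cvgM (cvg_cst _) (c 0))).
Qed.

Lemma orient_conv A B P Q (t : R) :
  orient A B (P + t *: (Q - P)) = (1 - t) * orient A B P + t * orient A B Q.
Proof. by rewrite /orient !mxE; ring. Qed.

Lemma segment_is_connected P Q :
  connected ((fun t : R => P + t *: (Q - P)) @` `[0, 1]).
Proof.
apply: connected_continuous_connected; first exact: segment_connected.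
apply: continuous_subspaceT => t.
by apply: cvgD; [exact: cvg_cst|apply: cvgZr_tmp; exact: cvg_id].
Qed.

(** The orientation is affine along the segment from [P] to [Q], so with equal signs the segment
    avoids the line. Conversely it maps a connected set containing both points onto an interval,
    which contains 0 when the signs differ. *)
Lemma separates_lineP A B P Q : A <> B ->
  separates (line A B) P Q <-> orient A B P * orient A B Q < 0.
Proof.
move=> AB; split.
  move=> [nP nQ dPQ]; rewrite ltNge; apply/negP => oPQ; apply: dPQ.
  have oP : orient A B P != 0 by apply/eqP => /(lineP _ AB).
  have oQ : orient A B Q != 0 by apply/eqP => /(lineP _ AB).
  apply: same_connected_component.
  exists ((fun t : R => P + t *: (Q - P)) @` `[0, 1]); last first.
    by exists 1; rewrite /= ?in_itv /= ?ler01 ?lexx // scale1r addrC subrK.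
  split; last exact: segment_is_connected.
    by exists 0; rewrite /= ?in_itv /= ?ler01 ?lexx // scale0r addr0.
  move=> _ [t + <-] /(lineP _ AB); rewrite /= in_itv /= orient_conv => /andP[t0 t1].
  move: oP oQ; rewrite !neq_lt => /orP[] oP /orP[] oQ; nra.
move=> oPQ; split; try by move=> /(lineP _ AB) e; move: oPQ; rewrite e ?mul0r ?mulr0 ltxx.
have [nP nQ] : ~ line A B P /\ ~ line A B Q.
  by split => /(lineP _ AB) e; move: oPQ; rewrite e ?mul0r ?mulr0 ltxx.
move=> eC; have : connected_component (~` line A B) P Q.
  by rewrite eC; exact: connected_component_refl.
move=> [D [DP DL Dc] DQ].
have /connected_intervalP iD : connected (orient A B @` D).
  apply: connected_continuous_connected Dc _.
  by apply: continuous_subspaceT; exact: orient_continuous.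
suff [X DX X0] : (orient A B @` D) 0 by apply: (DL X DX); apply/lineP.
have DP' : (orient A B @` D) (orient A B P) by exists P.
have DQ' : (orient A B @` D) (orient A B Q) by exists Q.
have [oP|oP] := ltP (orient A B P) 0.
  by apply: (iD _ _ DP' DQ'); apply/andP; split; nra.
by apply: (iD _ _ DQ' DP'); apply/andP; split; nra.
Qed.


(** * Convex hulls and their edges *)

Lemma sub_hull C : C `<=` hull C. Proof. exact: sub_gen_smallest. Qed.

Lemma hull_conv C P Q (t : R) : 0 <= t -> t <= 1 ->
  hull C P -> hull C Q -> hull C (t *: P + (1 - t) *: Q).
Proof.
move=> t0 t1 hP hQ D [cD CD].
have /set_mem := cD P Q (Itv01 t0 t1) (mem_set (hP D (conj cD CD))) (mem_set (hQ D (conj cD CD))).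
exact.
Qed.

Lemma hull_min C (D : set plane) :
    (forall P Q (t : R), 0 < t -> t < 1 -> D P -> D Q ->
       D (t *: P + (1 - t) *: Q)) ->
  C `<=` D -> hull C `<=` D.
Proof.
move=> cD CD P; apply; split=> //; apply/convex_setW => X Y /set_mem DX /set_mem DY.
by move=> k k0 k1; apply/mem_set; exact: cD.
Qed.

Lemma hull_mono C (D : set plane) : C `<=` D -> hull C `<=` hull D.
Proof.
move=> CD; apply: hull_min => [P Q t t0 t1|]; last by move=> P /CD; exact: sub_hull.
by apply: hull_conv; exact: ltW.
Qed.

(** Two nested binary combinations: first [P1] with [P2], weighted by [w1] and [w2], then their
    barycentre with [P3]. *)
Lemma hull_barycenter C (P1 P2 P3 Q : plane) (w1 w2 w3 : R) :
    C P1 -> C P2 -> C P3 -> 0 < w1 -> 0 < w2 -> 0 < w3 ->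
    w1 *: P1 + w2 *: P2 + w3 *: P3 = (w1 + w2 + w3) *: Q ->
  hull C Q.
Proof.
move=> /sub_hull C1 /sub_hull C2 /sub_hull C3 w1_gt0 w2_gt0 w3_gt0 eQ.
have w12 : 0 < w1 + w2 by rewrite addr_gt0.
have w123 : 0 < w1 + w2 + w3 by rewrite addr_gt0.
have frac (a b : R) : 0 < a -> 0 < b -> 0 <= a / (a + b) /\ a / (a + b) <= 1.
  move=> a0 b0; split; first by rewrite divr_ge0 // ltW // addr_gt0.
  by rewrite ler_pdivrMr ?addr_gt0 // mul1r lerDl ltW.
have [u0 u1] := frac _ _ w1_gt0 w2_gt0; have [s0 s1] := frac _ _ w12 w3_gt0.
have := hull_conv s0 s1 (hull_conv u0 u1 C1 C2) C3.
rewrite (_ : _ + _ = Q) //.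
apply: (scalerI (lt0r_neq0 w123)); rewrite -eQ !scalerDr !scalerA.
by congr (_ *: _ + _ *: _ + _ *: _); field; rewrite !lt0r_neq0.
Qed.

(** The orientation as a linear functional up to a constant, the form in which [hull_edge] expects a
    supporting line. *)
Lemma orient_dot A B P :
  (P *m (\col_(i < 2) (if i == 0 then A 0 1 - B 0 1 else B 0 0 - A 0 0))) 0 0
  = orient A B P + ((B 0 0 - A 0 0) * A 0 1 - (B 0 1 - A 0 1) * A 0 0).
Proof.
rewrite mxE !big_ord_recl big_ord0 !mxE /= /orient.
rewrite (_ : lift ord0 ord0 = 1); last exact: val_inj.
by rewrite (_ : ord0 = 0) //; ring.
Qed.

Lemma orient_convl A B P Q (t : R) :
  orient A B (t *: P + (1 - t) *: Q) = t * orient A B P + (1 - t) * orient A B Q.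
Proof. by rewrite /orient !mxE; ring. Qed.

Lemma hull_orient0 A B P : hull [set A; B] P -> orient A B P = 0.
Proof.
move: P; apply: hull_min => [P Q t _ _ oP oQ|P [->|->]]; rewrite /= /orient.
- by rewrite -/(orient _ _ _) orient_convl oP oQ !mulr0 addr0.
- by ring.
- by ring.
Qed.

Lemma supporting_hull_edge C A B : C A -> C B -> A <> B ->
    (forall P, C P -> P <> A -> P <> B -> orient A B P < 0) ->
  hull_edge C A B.
Proof.
move=> CA CB AB oC; split=> //.
exists (\col_(i < 2) (if i == 0 then A 0 1 - B 0 1 else B 0 0 - A 0 0)).
exists ((B 0 0 - A 0 0) * A 0 1 - (B 0 1 - A 0 1) * A 0 0).
(* The open half-plane to the right of [A B] together with the segment is convex; hence the hull
   meets the line in the segment only. *)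
pose D := [set P | orient A B P < 0 \/ hull [set A; B] P].
have CD : hull C `<=` D.
  apply: hull_min => [P Q t t0 t1|P CP].
    have t1' : 0 < 1 - t by rewrite subr_gt0.
    move=> [oP|hP] [oQ|hQ]; last by right; apply: hull_conv => //; exact: ltW.
    - by left; rewrite orient_convl; nra.
    - by left; rewrite orient_convl (hull_orient0 hQ); nra.
    - by left; rewrite orient_convl (hull_orient0 hP); nra.
  have [->|/eqP PA] := eqVneq P A; first by right; apply: sub_hull; left.
  have [->|/eqP PB] := eqVneq P B; first by right; apply: sub_hull; right.
  by left; exact: oC.
split.
- apply/eqP => a0; apply: AB; apply: plane_eqP.
    by move: a0 => /colP/(_ 1); rewrite !mxE /=; lra.
  by move: a0 => /colP/(_ 0); rewrite !mxE /=; lra.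
- move=> P /CD; rewrite orient_dot => -[oP|/hull_orient0 oP]; last by rewrite oP add0r.
  by lra.
- apply/seteqP; split=> P.
    move=> hP; split; last by rewrite /= orient_dot (hull_orient0 hP) add0r.
    by apply: hull_mono hP => X [->|->].
  by move=> [/CD [oP|//]]; rewrite /= orient_dot => e; exfalso; move: oP e; lra.
Qed.

End Geometry.

(** * Sums over quadruples and signs *)

Section Sums.
Variable T : finType.
Implicit Types (f : T -> T -> T -> T -> nat).

Definition sum4 f : nat :=
  (\sum_a \sum_b \sum_c \sum_d f a b c d)%N.

Lemma eq_sum4 f g : (forall a b c d, f a b c d = g a b c d) ->
  sum4 f = sum4 g.
Proof. by move=> e; do 4![apply: eq_bigr => ? _]; exact: e. Qed.

Lemma leq_sum4 f g : (forall a b c d, f a b c d <= g a b c d)%N ->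
  (sum4 f <= sum4 g)%N.
Proof. by move=> e; do 4![apply: leq_sum => ? _]; exact: e. Qed.

Lemma sum4D f g :
  sum4 (fun a b c d => f a b c d + g a b c d)%N = (sum4 f + sum4 g)%N.
Proof. by rewrite /sum4 -big_split; do 3![apply: eq_bigr => ? _; rewrite -big_split]. Qed.

Lemma sum4M k f : sum4 (fun a b c d => k * f a b c d)%N = (k * sum4 f)%N.
Proof. by rewrite /sum4 big_distrr; do 3![apply: eq_bigr => ? _; rewrite big_distrr]. Qed.

Lemma sum4_swap12 f : sum4 (fun a b c d => f b a c d) = sum4 f.
Proof. exact: exchange_big. Qed.

Lemma sum4_swap23 f : sum4 (fun a b c d => f a c b d) = sum4 f.
Proof. by apply: eq_bigr => a _; exact: exchange_big. Qed.

Lemma sum4_swap34 f : sum4 (fun a b c d => f a b d c) = sum4 f.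
Proof. by do 2![apply: eq_bigr => ? _]; exact: exchange_big. Qed.

Lemma sum4_swap_pairs f : sum4 (fun a b c d => f c d a b) = sum4 f.
Proof.
rewrite (sum4_swap23 (fun a b c d => f b d a c)).
rewrite (sum4_swap12 (fun a b c d => f a d b c)).
rewrite (sum4_swap34 (fun a b c d => f a c b d)).
exact: sum4_swap23.
Qed.

(* One term for each way of splitting [a, b, c, d] into a first and a second pair. *)
Definition pairings_sum f a b c d : nat :=
  (f a b c d + f c d a b + f a c b d + f b d a c + f a d b c + f b c a d)%N.

(** Each of the six terms is a relabelling of the summation variables. *)
Lemma sum4_pairings f : sum4 (pairings_sum f) = (6 * sum4 f)%N.
Proof.
have e3 : sum4 (fun a b c d => f a c b d) = sum4 f by exact: sum4_swap23.
have e6 : sum4 (fun a b c d => f b c a d) = sum4 f.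
  by rewrite -e3 (sum4_swap12 (fun a b c d => f a c b d)).
have e5 : sum4 (fun a b c d => f a d b c) = sum4 f.
  by rewrite -e3 (sum4_swap34 (fun a b c d => f a c b d)).
have e4 : sum4 (fun a b c d => f b d a c) = sum4 f.
  by rewrite -e5 (sum4_swap12 (fun a b c d => f a d b c)).
by rewrite /pairings_sum !sum4D (sum4_swap_pairs f) e3 e4 e5 e6; lia.
Qed.

(** A duplicate-free [s] can be extended by [#|T| - size s] fresh elements. The weight [k] allows
    nested sums to be evaluated from the inside outwards. *)
Lemma sum_uniq_cons (s : seq T) k :
  (\sum_x uniq (x :: s) * k = uniq s * ((#|T| - size s) * k))%N.
Proof.
rewrite -big_distrl mulnA; congr (_ * k)%N.
case: (boolP (uniq s)) => us; last first.
  by rewrite mul0n big1 // => x _; rewrite /= (negbTE us) andbF.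
rewrite mul1n -(card_uniqP us) -(cardC (mem s)) addKn -sum1_card [RHS]big_mkcond /=.
by apply: eq_bigr => x _; rewrite us andbT inE; case: (x \in s).
Qed.

Lemma sum4_uniq :
  sum4 (fun a b c d => uniq [:: d; c; b; a]) = (#|T| ^_ 4)%N.
Proof.
transitivity (sum4 (fun a b c d => uniq [:: d; c; b; a] * 1)%N).
  by apply: eq_sum4 => a b c d; rewrite muln1.
rewrite /sum4.
under eq_bigr => a _ do under eq_bigr => b _ do under eq_bigr => c _ do rewrite sum_uniq_cons [size _]/=.
under eq_bigr => a _ do under eq_bigr => b _ do rewrite sum_uniq_cons [size _]/=.
under eq_bigr => a _ do rewrite sum_uniq_cons [size _]/=.
rewrite sum_uniq_cons /= !ffactnS ffactn0; lia.
Qed.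

Lemma sum_sym_rank (f : T -> T -> nat) :
    (forall x y, f x y = f y x) -> (forall x, f x x = 0%N) ->
  (\sum_x \sum_y f x y =
   2 * \sum_x \sum_(y | enum_rank x < enum_rank y) f x y)%N.
Proof.
move=> fC f0; rewrite mul2n -addnn [in X in (_ + X)%N](exchange_big_dep predT) //= -big_split.
apply: eq_bigr => x _; rewrite (bigID (fun y => enum_rank x < enum_rank y)%N) /=.
congr (_ + _)%N; rewrite (bigD1 x) ?ltnn //= f0 add0n.
apply: eq_big => [y|y _]; last exact: fC.
by rewrite -leqNgt andbC [RHS]ltn_neqAle (inj_eq val_inj) (inj_eq enum_rank_inj).
Qed.

End Sums.

Section Signs.
Variable R : realDomainType.
Implicit Types x y : R.

Lemma pmul_signs x y : x != 0 -> y != 0 -> (0 < x * y) = ((0 < x) == (0 < y)).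
Proof.
rewrite !neq_lt => /orP[] hx /orP[] hy.
- by rewrite nmulr_rgt0 // hy !ltNge !ltW.
- by rewrite nmulr_rgt0 // hy !ltNge !ltW.
- by rewrite pmulr_rgt0 // hx.
- by rewrite pmulr_rgt0 // hx hy.
Qed.

(** The six pairs appear in the order of the splittings in [pairings_sum]. *)
Definition like_signs (A B C D : R) : nat :=
  ((0 < C * D)%R + (0 < A * B)%R + (0 < B * D)%R + (0 < A * C)%R + (0 < B * C)%R
   + (0 < A * D)%R)%N.

Definition balanced (A B C D : R) : bool :=
  ((0 < A)%R + (0 < B)%R + (0 < C)%R + (0 < D)%R == 2)%N.

(** With [k] positive numbers among the four there are [C(k, 2) + C(4 - k, 2)] pairs of like sign;
    the minimum, two, occurs at [k = 2]. *)
Lemma like_signs_ge2 A B C D :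
  A != 0 -> B != 0 -> C != 0 -> D != 0 -> (2 <= like_signs A B C D)%N.
Proof.
move=> A0 B0 C0 D0; rewrite /like_signs !pmul_signs //.
by do 4![case: (0 < _)].
Qed.

Lemma like_signs_balanced A B C D :
    A != 0 -> B != 0 -> C != 0 -> D != 0 -> balanced A B C D ->
  like_signs A B C D = 2%N.
Proof.
move=> A0 B0 C0 D0; rewrite /balanced /like_signs !pmul_signs //.
by do 4![case: (0 < _)].
Qed.

End Signs.

(** * Planar configurations *)

Section Configuration.
Variables (R : realType) (T : finType) (p : T -> 'rV[R]_2).
Implicit Types a b c d u v x y z : T.

Definition ori x y z : R := orient (p x) (p y) (p z).

Definition sep a b c d : bool := ori a b c * ori a b d < 0.

Lemma ori_rot x y z : ori y z x = ori x y z.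
Proof. by rewrite /ori /orient; ring. Qed.

Lemma oriC x y z : ori y x z = - ori x y z.
Proof. by rewrite /ori /orient; ring. Qed.

Lemma ori_id x z : ori x x z = 0.
Proof. by rewrite /ori /orient; ring. Qed.

Lemma ori_idl x y : ori x y x = 0.
Proof. by rewrite /ori /orient; ring. Qed.

Lemma ori_idr x y : ori x y y = 0.
Proof. by rewrite /ori /orient; ring. Qed.

Lemma sepC a b c d : sep b a c d = sep a b c d.
Proof. by rewrite /sep !(oriC a b) mulrNN. Qed.

Lemma sepCr a b c d : sep a b d c = sep a b c d.
Proof. by rewrite /sep mulrC. Qed.

Lemma sep_uniq a b c d : sep a b c d -> uniq [:: d; c; b; a].
Proof.
rewrite /sep /= !inE !negb_or !andbT => s.
by do !(apply/andP; split); apply/eqP => e; move: s;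
  rewrite e ?ori_id ?ori_idl ?ori_idr ?mulr0 ?mul0r ?ltxx // -expr2 ltNge sqr_ge0.
Qed.

(** The four arguments on the right are the coefficients of the affine dependence between the four
    points. The line [a b] separates [c] and [d] exactly when the coefficients of [c] and [d] have
    the same strict sign. *)
Lemma sep_pairings a b c d :
  pairings_sum (fun a b c d => sep a b c d : nat) a b c d =
  like_signs (ori b c d) (- ori a c d) (ori a b d) (- ori a b c).
Proof.
rewrite /pairings_sum /like_signs /sep.
by congr (nat_of_bool _ + nat_of_bool _ + nat_of_bool _ + nat_of_bool _ +
  nat_of_bool _ + nat_of_bool _)%N; rewrite -oppr_gt0; congr (0 < _);
  rewrite /ori /orient; ring.
Qed.

Lemma sep_pairings_eq0 a b c d : ~~ uniq [:: d; c; b; a] ->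
  pairings_sum (fun a b c d => sep a b c d : nat) a b c d = 0%N.
Proof.
move=> nu; have s0 a' b' c' d' : perm_eq [:: d'; c'; b'; a'] [:: d; c; b; a] ->
    sep a' b' c' d' = false.
  move=> pe; apply/negbTE; apply: contra nu => /sep_uniq.
  by rewrite (perm_uniq pe).
by rewrite /pairings_sum !s0 //; apply/permP => P /=; lia.
Qed.

Hypothesis p_inj : injective p.
Hypothesis p_gen : generic (range p).

Lemma ori_neq0 x y z : x != y -> x != z -> y != z -> ori x y z != 0.
Proof.
move=> /eqP xy /eqP xz /eqP yz; apply/eqP => o0.
have pxy : p x <> p y by move/p_inj.
apply: (p_gen.2 (p x) (p y) (p z)); try by [exists x|exists y|exists z|move/p_inj].
exists (line (p x) (p y)); split; first by exists (p x), (p y).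
- by apply/(lineP _ pxy); rewrite -/(ori _ _ _) ori_idl.
- by apply/(lineP _ pxy); rewrite -/(ori _ _ _) ori_idr.
- exact/(lineP _ pxy).
Qed.

Lemma ori_eq0 x y z : x != y -> ori x y z = 0 -> z = x \/ z = y.
Proof.
move=> xy o0; have [->|zx] := eqVneq z x; first by left.
have [->|zy] := eqVneq z y; first by right.
by have := @ori_neq0 x y z xy; rewrite o0 eqxx eq_sym zx eq_sym zy => /(_ isT isT).
Qed.

Lemma uniq_ori_neq0 a b c d : uniq [:: d; c; b; a] ->
  [/\ ori b c d != 0, - ori a c d != 0, ori a b d != 0 & - ori a b c != 0].
Proof.
rewrite /= !inE !negb_or !andbT => /andP[/and3P[dc db da] /andP[/andP[cb ca] ba]].
by split; rewrite ?oppr_eq0; apply: ori_neq0; rewrite // eq_sym.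
Qed.

Lemma sum4_sep_ge : (2 * #|T| ^_ 4 <= 6 * sum4 (fun a b c d => sep a b c d))%N.
Proof.
rewrite -sum4_pairings -sum4_uniq -sum4M; apply: leq_sum4 => a b c d.
case: (boolP (uniq _)) => // u; rewrite sep_pairings.
by have [? ? ? ?] := uniq_ori_neq0 u; exact: like_signs_ge2.
Qed.

(** For points in general position this says that any four are the vertices of a convex
    quadrilateral. *)
Definition balanced_config := forall a b c d, uniq [:: d; c; b; a] ->
  balanced (ori b c d) (- ori a c d) (ori a b d) (- ori a b c).

Lemma sum4_sep_balanced : balanced_config ->
  (6 * sum4 (fun a b c d => sep a b c d) = 2 * #|T| ^_ 4)%N.
Proof.
move=> bal; rewrite -sum4_pairings -sum4_uniq -sum4M; apply: eq_sum4 => a b c d.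
case: (boolP (uniq _)) => u; last by rewrite sep_pairings_eq0.
by rewrite sep_pairings; have [? ? ? ?] := uniq_ori_neq0 u;
  rewrite like_signs_balanced //; exact: bal.
Qed.

(** Three coefficients of one sign would make [p d] a convex combination of the other three
    points. *)
Lemma convex_position_excludes a b c d (A B C D : R) :
    convex_position (range p) -> a != d -> b != d -> c != d ->
    A + B + C + D = 0 ->
    (forall i, A * p a 0 i + B * p b 0 i + C * p c 0 i + D * p d 0 i = 0) ->
  ~ [/\ 0 < A, 0 < B & 0 < C] /\ ~ [/\ A < 0, B < 0 & C < 0].
Proof.
move=> cvx ad bd cd.
have inC x : x != d -> (range p `\ p d) (p x).
  by move=> /eqP xd; split; [exists x|move/p_inj].
(* Negating all the coefficients turns the second claim into the first. *)
wlog suff pos : A B C D / A + B + C + D = 0 ->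
    (forall i, A * p a 0 i + B * p b 0 i + C * p c 0 i + D * p d 0 i = 0) ->
    ~ [/\ 0 < A, 0 < B & 0 < C].
  move=> e0 e; split; first exact: pos e0 e.
  have e0' : - A - B - C - D = 0 by lra.
  have e' i : - A * p a 0 i - B * p b 0 i - C * p c 0 i - D * p d 0 i = 0.
    by have := e i; lra.
  have := pos (- A) (- B) (- C) (- D) e0'; rewrite !oppr_gt0; apply=> i.
  by rewrite -(e' i); ring.
move=> e0 e [A0 B0 C0]; apply: (cvx (p d)); first by exists d.
apply: (hull_barycenter (inC a ad) (inC b bd) (inC c cd) A0 B0 C0).
by apply/rowP => i; have := e i; rewrite !mxE (_ : D = - (A + B + C)); [lra|lra].
Qed.

(** Whichever point is left out, the other three coefficients cannot share a sign; this leaves two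
    of each sign. *)
Lemma convex_balanced : convex_position (range p) -> balanced_config.
Proof.
move=> cvx a b c d u; have [A0 B0 C0 D0] := uniq_ori_neq0 u.
move: u; rewrite /= !inE !negb_or !andbT => /andP[/and3P[dc db da] /andP[/andP[cb ca] ba]].
have [cd bd ad] : [/\ c != d, b != d & a != d] by rewrite !(eq_sym _ d).
have [bc ac ab] : [/\ b != c, a != c & a != b].
  by rewrite !(eq_sym _ c) (eq_sym a b).
have e0 : ori b c d + - ori a c d + ori a b d + - ori a b c = 0.
  by rewrite /ori /orient; ring.
have e i : ori b c d * p a 0 i + (- ori a c d) * p b 0 i + ori a b d * p c 0 i
    + (- ori a b c) * p d 0 i = 0.
  case: i => [[|[|//]] lt_i].
    by rewrite (_ : Ordinal lt_i = 0) /ori /orient; [ring|apply: val_inj].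
  by rewrite (_ : Ordinal lt_i = 1) /ori /orient; [ring|apply: val_inj].
move: A0 B0 C0 D0 e0 e; rewrite /balanced.
move: (ori b c d) (- ori a c d) (ori a b d) (- ori a b c) => A B C D.
move=> A0 B0 C0 D0 e0 e.
have [dp dn] := convex_position_excludes cvx ad bd cd e0 e.
have [cp cn] : ~ [/\ 0 < A, 0 < B & 0 < D] /\ ~ [/\ A < 0, B < 0 & D < 0].
  apply: (@convex_position_excludes a b d c A B D C) => //; first by lra.
  by move=> i; have := e i; lra.
have [bp bn] : ~ [/\ 0 < A, 0 < C & 0 < D] /\ ~ [/\ A < 0, C < 0 & D < 0].
  apply: (@convex_position_excludes a c d b A C D B) => //; first by lra.
  by move=> i; have := e i; lra.
have [ap an] : ~ [/\ 0 < B, 0 < C & 0 < D] /\ ~ [/\ B < 0, C < 0 & D < 0].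
  apply: (@convex_position_excludes b c d a B C D A) => //; first by lra.
  by move=> i; have := e i; lra.
move: A0 B0 C0 D0; rewrite !neq_lt => /orP[] hA /orP[] hB /orP[] hC /orP[] hD;
  rewrite ?hA ?hB ?hC ?hD ?(lt_gtF hA) ?(lt_gtF hB) ?(lt_gtF hC) ?(lt_gtF hD) //;
  exfalso; by [apply: ap|apply: an|apply: bp|apply: bn|apply: cp|apply: cn|apply: dp|apply: dn].
Qed.

(** As no three points are collinear, a separating line comes from exactly one unordered pair, whose
    two orders give the factor 2. *)
Lemma nsep_sum u v :
  (2 * nsep (range p) (p u) (p v) = \sum_x \sum_y sep x y u v)%N.
Proof.
rewrite sum_sym_rank => [|x y|x]; last 2 first.
- by rewrite sepC.
- by rewrite /sep ori_id mul0r ltxx.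
congr (2 * _)%N; rewrite pair_big_dep /=.
pose D := [pred xy : T * T | (enum_rank xy.1 < enum_rank xy.2)%N && sep xy.1 xy.2 u v].
have -> : (\sum_(xy : T * T | enum_rank xy.1 < enum_rank xy.2) sep xy.1 xy.2 u v
    = #|D|)%N.
  rewrite -[RHS]sum1_card big_mkcond [RHS]big_mkcond /=.
  by apply: eq_bigr => xy _; rewrite inE /=; case: ifP => //=; case: sep.
pose f (xy : T * T) := line (p xy.1) (p xy.2).
have neq x y : sep x y u v -> x != y.
  by apply: contraTneq => ->; rewrite /sep ori_id mul0r ltxx.
have pneq x y : x != y -> p x <> p y by move=> /eqP xy /p_inj.
rewrite /nsep (_ : [set L | _] = [set` [fset f xy | xy in D]%fset]); last first.
  apply/seteqP; split=> L /=.
    move=> [[_ [_ [[[x _ <-] nx] [[y _ <-] ny] xy ->]]]].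
    move=> /(separates_lineP _ _ xy) s.
    have [lt_xy|lt_yx|/ord_inj/enum_rank_inj e] := ltngtP (enum_rank x) (enum_rank y).
    + by apply/imfsetP; exists (x, y) => //=; rewrite inE /= lt_xy.
    + apply/imfsetP; exists (y, x) => /=; first by rewrite inE /= lt_yx sepC.
      have yx : p y <> p x by move=> e; apply: xy.
      apply/seteqP; split=> P.
        by move/(lineP _ xy) => o0; apply/(lineP _ yx); move: o0; rewrite /orient; lra.
      by move/(lineP _ yx) => o0; apply/(lineP _ xy); move: o0; rewrite /orient; lra.
    + by exfalso; apply: xy; rewrite e.
  move/imfsetP => [[x y]] /=; rewrite inE /= => /andP[_ s] ->.
  have xy := pneq _ _ (neq _ _ s); split; last exact/(separates_lineP _ _ xy).
  (* The points spanning the line are neither [u] nor [v], as [nsep] demands. *)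
  have := sep_uniq s; rewrite /= !inE !negb_or !andbT.
  move=> /andP[/and3P[_ vy vx] /andP[/andP[uy ux] _]].
  exists (p x), (p y); split => //; (split; first by eexists).
    by move=> [/p_inj|/p_inj] e; [move: ux|move: vx]; rewrite e eqxx.
  by move=> [/p_inj|/p_inj] e; [move: uy|move: vy]; rewrite e eqxx.
rewrite set_fsetK card_in_imfset /=; first by rewrite -cardE.
move=> [x y] [x' y'] /= /andP[lt_xy s] /andP[lt_xy' s'] e.
have xy := neq _ _ s; have xy' := neq _ _ s'.
(* The line meets the configuration in two points only, so the two pairs agree up to order, and the
   ranks fix the order. *)
have on z : line (p x') (p y') (p z) -> z = x \/ z = y.
  by rewrite /f /= in e; rewrite -e => /(lineP _ (pneq _ _ xy)); exact: ori_eq0.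
have := on x' ((lineP _ (pneq _ _ xy')).2 (ori_idl _ _)).
have := on y' ((lineP _ (pneq _ _ xy')).2 (ori_idr _ _)).
move=> [ey|ey] [ex|ex]; subst => //; try by rewrite ltnn in lt_xy'.
by have := ltn_trans lt_xy lt_xy'; rewrite ltnn.
Qed.

(** * Colour signs and excesses *)

Variable sg : T -> int.
Hypothesis sg_sign : forall x, sg x = 1 \/ sg x = -1.
Hypothesis sum_sg : \sum_x sg x = 0.

Definition excess x y : int := \sum_u sg u * sgz (ori x y u).

(** If a sign is 0, both products vanish; otherwise the squares are 1 and the difference is 0 or
    2. *)
Lemma sep_sgz a b c d :
  (2 * sep a b c d)%:Z = sgz (ori a b c) ^+ 2 * sgz (ori a b d) ^+ 2
                         - sgz (ori a b c) * sgz (ori a b d).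
Proof.
by rewrite /sep -sgz_lt0 sgzM; case: (sgzP (ori a b c)) => _; case: (sgzP (ori a b d)).
Qed.

(** By genericity the squares are 1 except at [x] and [y], so only these two are missing from the
    zero total of [sg]. *)
Lemma sum_sg_sgz2 x y : x != y -> \sum_u sg u * sgz (ori x y u) ^+ 2 = - (sg x + sg y).
Proof.
move=> xy; move: sum_sg; rewrite (bigD1 x) // (bigD1 y) 1?eq_sym //= => s0.
rewrite (bigD1 x) // (bigD1 y) 1?eq_sym //= ori_idl ori_idr sgz0.
rewrite expr0n /= !mulr0 !add0r (eq_bigr sg) => [|z /andP[zx zy]].
  by move: s0; move: (\sum_(i | _) _) => z; lia.
have := @ori_neq0 x y z xy; rewrite eq_sym zx eq_sym zy => /(_ isT isT) nz.
by case: sgzP nz => // _ _; lia.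
Qed.

Lemma Posz_sum2 (f : T -> T -> nat) :
  (\sum_x \sum_y f x y)%N%:Z = \sum_x \sum_y (f x y)%:Z.
Proof.
rewrite (big_morph Posz PoszD (erefl _)); apply: eq_bigr => x _.
exact: (big_morph Posz PoszD (erefl _)).
Qed.

Lemma sqr_sum2 (f : T -> int) : (\sum_x f x) ^+ 2 = \sum_x \sum_y f x * f y.
Proof. by rewrite expr2 big_distrlr. Qed.

(** The factor [1 - sg c * sg d] is twice the indicator of different signs. It is multiplied by
    [sep_sgz] and summed over [c] and [d]; the terms in [sg c * sg d] factor into the two
    squares. *)
Lemma excess_line x y :
  (4 * (\sum_c \sum_d (sg c != sg d) * sep x y c d))%N%:Z =
  (2 * (\sum_c \sum_d sep x y c d))%N%:Z + excess x y ^+ 2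
  - (\sum_u sg u * sgz (ori x y u) ^+ 2) ^+ 2.
Proof.
rewrite !sqr_sum2 !PoszM !Posz_sum2 !big_distrr -big_split -sumrB /=.
apply: eq_bigr => c _; rewrite !big_distrr -big_split -sumrB /=.
apply: eq_bigr => d _.
have := sep_sgz x y c d; rewrite !expr2 !PoszM.
by case: (sg_sign c) (sg_sign d) => -> [] ->; rewrite /=; lia.
Qed.

Lemma sumz_const (k : int) : \sum_(x : T) k = k * #|T|%:Z.
Proof.
have -> : \sum_(x : T) k = \sum_(x in T) k by apply: eq_bigl.
by rewrite sumr_const -[LHS]mulr_natr natz.
Qed.

Lemma sum_sg_sgz2_sqr :
  \sum_x \sum_y (\sum_u sg u * sgz (ori x y u) ^+ 2) ^+ 2
  = 2 * #|T|%:Z ^+ 2 - 4 * #|T|%:Z.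
Proof.
transitivity (\sum_(x : T) (2 * #|T|%:Z - 4)).
  (* Off the diagonal the summand is [(sg x + sg y) ^ 2]; on it the sum is 0 and the correction [4]
     cancels [2 + 2]. *)
  apply: eq_bigr => x _; transitivity (\sum_y (2 + 2 * sg x * sg y - 4 * (x == y)%:Z)).
    apply: eq_bigr => y _; have [<-|xy] := eqVneq x y.
      rewrite big1 => [|u _]; last by rewrite ori_id sgz0 expr0n mulr0.
      by case: (sg_sign x) => ->.
    rewrite sum_sg_sgz2 //.
    by case: (sg_sign x) (sg_sign y) => -> [] ->.
  rewrite sumrB big_split /= -!big_distrr /= sum_sg mulr0 addr0 sumz_const.
  rewrite (bigD1 x) //= eqxx big1 => [|y /negbTE]; last by rewrite eq_sym => ->.
  by rewrite addr0 mulr1.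
by rewrite sumz_const; ring.
Qed.

Lemma excess_identity :
  (4 * sum4 (fun a b c d => (sg c != sg d) * sep a b c d)%N)%N%:Z
    + (2 * #|T|%:Z ^+ 2 - 4 * #|T|%:Z) =
  (2 * sum4 (fun a b c d => sep a b c d))%N%:Z + \sum_x \sum_y excess x y ^+ 2.
Proof.
rewrite -sum_sg_sgz2_sqr /sum4 !big_distrr.
under eq_bigr do rewrite big_distrr.
under [X in _ = X%:Z + _]eq_bigr do rewrite big_distrr.
rewrite !Posz_sum2 -!big_split /=; apply: eq_bigr => x _.
rewrite -!big_split /=; apply: eq_bigr => y _.
by rewrite excess_line subrK.
Qed.

(** * Vanishing of the excesses *)

Section Balanced.
Hypothesis bal : balanced_config.
(** Alternation of the colours, stated for the hull edges as pairs with no point on their left. *)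
Hypothesis edge_sg : forall x y, x != y ->
  (forall z, ori x y z <= 0) -> sg x + sg y = 0.

(* Cutting the chain of points on the left of [x y] at one of them, [z], yields
   the chains of points on the left of [x z] and of [z y]. *)
Lemma left_split x y z v : 0 < ori x y z -> v != z ->
  (nat_of_bool (0 < ori x y v)%R = (0 < ori x z v)%R + (0 < ori z y v)%R)%N.
Proof.
move=> oz vz; have [xy xz yz] : [/\ x != y, x != z & y != z].
  by split; apply: contraTneq oz => ->; rewrite ?ori_id ?ori_idl ?ori_idr ltxx.
have [->|vx] := eqVneq v x.
  by rewrite !ori_idl !ltxx (oriC y z) ori_rot oppr_gt0 (lt_gtF oz).
have [->|vy] := eqVneq v y.
  by rewrite !ori_idr !ltxx (oriC z x) -(ori_rot z x y) oppr_gt0 (lt_gtF oz).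
have u : uniq [:: v; z; y; x].
  by rewrite /= !inE !negb_or vz vy vx (eq_sym z) yz (eq_sym z) xz eq_sym xy.
have [A0 B0 C0 D0] := uniq_ori_neq0 u.
(* Since [- ori x y z] is negative, exactly one of the other three coefficients is negative; each of
   the three remaining patterns agrees with the claim. *)
have := bal u; rewrite /balanced (oriC y z) !oppr_gt0 (lt_gtF oz).
move: A0 B0 C0; rewrite oppr_eq0 !neq_lt => /orP[] hA /orP[] hB /orP[] hC;
  by rewrite ?hA ?hB ?hC ?(lt_gtF hA) ?(lt_gtF hB) ?(lt_gtF hC).
Qed.

(** Induction on the number of points to the left of [x y]. If there are none, [x y] is a hull edge;
    otherwise [z] contributes [sg z], and each of the two subchains contributes half of [- sg z],
    which cancels it. *)
Lemma sum_left x y : x != y ->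
  2 * \sum_(v | 0 < ori x y v) sg v = - (sg x + sg y).
Proof.
have [m] := ubnP #|[pred v | 0 < ori x y v]|.
elim: m x y => // m IH x y lt_m xy.
have [/existsP[z oz]|/existsPn no] := boolP [exists z, 0 < ori x y z]; last first.
  rewrite big_pred0 => [|v]; last exact/negbTE/no.
  by rewrite mulr0 edge_sg ?oppr0 // => z; rewrite leNgt; exact: no.
have [xz zy] : x != z /\ z != y.
  by split; apply: contraTneq oz => ->; rewrite ?ori_idl ?ori_idr ltxx.
have xzz : (0 < ori x z z) = false by rewrite ori_idr ltxx.
have zyz : (0 < ori z y z) = false by rewrite ori_idl ltxx.
have small a b : (0 < ori a b z) = false ->
    (forall v, v != z -> 0 < ori a b v -> 0 < ori x y v) ->
    (#|[pred v | (0 < ori a b v)%R]| < m)%N.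
  move=> abz sub; apply: leq_trans (_ : #|[pred v | (0 < ori x y v)%R]| <= m)%N; last by [].
  apply: proper_card; apply/properP; split; last by exists z; rewrite !inE ?abz.
  apply/fintype.subsetP => v; rewrite !inE => ov; apply: sub => //.
  by apply: contraTneq ov => ->; rewrite abz.
have subxz v : v != z -> 0 < ori x z v -> 0 < ori x y v.
  by move=> vz ov; have := left_split oz vz; rewrite ov; case: (0 < ori x y v).
have subzy v : v != z -> 0 < ori z y v -> 0 < ori x y v.
  by move=> vz ov; have := left_split oz vz; rewrite ov addn1; case: (0 < ori x y v).
have IH1 := IH x z (small _ _ xzz subxz) xz.
have IH2 := IH z y (small _ _ zyz subzy) zy.
have -> : \sum_(v | 0 < ori x y v) sg v =
    sg z + \sum_(v | 0 < ori x z v) sg v + \sum_(v | 0 < ori z y v) sg v.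
  rewrite (bigD1 z) //= -addrA; congr (_ + _).
  rewrite big_mkcond [in RHS]big_mkcond [X in _ = _ + X]big_mkcond -big_split /=.
  apply: eq_bigr => v _; have [->|vz] := eqVneq v z; first by rewrite andbF xzz zyz.
  have := left_split oz vz; rewrite andbT.
  by case: (0 < ori x y v); case: (0 < ori x z v); case: (0 < ori z y v); rewrite /= ?addr0 ?add0r.
by rewrite !mulrDr IH1 IH2; lia.
Qed.

Lemma excess_eq0 x y : excess x y = 0.
Proof.
have [<-|xy] := eqVneq x y.
  by rewrite /excess big1 // => u _; rewrite ori_id sgz0 mulr0.
have yx : y != x by rewrite eq_sym.
(* The points to the right of [x y] are those to the left of [y x]. *)
have -> : excess x y =
    \sum_(v | 0 < ori x y v) sg v - \sum_(v | 0 < ori y x v) sg v.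
  rewrite [X in X - _]big_mkcond [X in _ - X]big_mkcond -sumrB.
  apply: eq_bigr => v _; rewrite (oriC x y) oppr_gt0.
  by case: (sgzP (ori x y v)) => _; lia.
by have := sum_left xy; have := sum_left yx; lia.
Qed.

End Balanced.

End Configuration.

(** * Drawings of the complete bipartite graph *)

Section Knn.
Variables (R : realType) (n : nat).
Implicit Types (p : Knn n -> 'rV[R]_2) (u v : Knn n).

Definition colour u : int := if is_black u then 1 else -1.

Lemma colour_sign u : colour u = 1 \/ colour u = -1.
Proof. by rewrite /colour; case: is_black; [left|right]. Qed.

Lemma colour_neq u v : (colour u != colour v) = adj u v.
Proof. by rewrite /colour /= /Knn_adj; case: is_black; case: is_black. Qed.

Lemma sum_colour : \sum_u colour u = 0.
Proof. by rewrite big_sumType /= !sumr_const card_ord mulNrn subrr. Qed.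

Lemma card_Knn : #|Knn n| = n.*2.
Proof. by rewrite card_sum !card_ord addnn. Qed.

(** The factor 4 comes from the two orders of the points spanning a line and the two orders of the
    ends of an edge. *)
Lemma crossing_number_sum4 p : rectilinear_drawing p ->
  (4 * crossing_number p =
   sum4 (fun a b c d => (colour c != colour d) * sep p a b c d))%N.
Proof.
move=> [p_inj p_gen].
transitivity (\sum_c \sum_d adj c d * \sum_a \sum_b sep p a b c d)%N; last first.
  rewrite -sum4_swap_pairs; apply: eq_bigr => c _; apply: eq_bigr => d _.
  rewrite big_distrr; apply: eq_bigr => a _; rewrite big_distrr.
  by apply: eq_bigr => b _; rewrite colour_neq.
rewrite sum_sym_rank; last 2 first.
- move=> c d; rewrite adj_sym; congr (_ * _)%N.
  by do 2![apply: eq_bigr => ? _]; rewrite sepCr.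
- by move=> c; rewrite adj_irr.
rewrite (_ : 4 = 2 * 2)%N // -mulnA /crossing_number; congr (2 * _)%N.
rewrite big_distrr; apply: eq_bigr => c _ /=.
rewrite big_mkcondr big_distrr; apply: eq_bigr => d _ /=.
rewrite -nsep_sum //; case: Knn_adj; first by rewrite mul1n.
by rewrite muln0.
Qed.

(** The excess identity multiplied by 6, for vanishing excesses and [6 S] equal to
    [2 * n.*2 ^_ 4]. *)
Lemma binomial_identity :
  (6 * (16 * (4 * n * 'C(n, 3))) + 6 * (8 * (n * n.-1)) =
   4 * n.*2 ^_ 4)%N.
Proof.
have := bin_ffact n 3; rewrite !ffactnS !ffactn0.
case: n => [|[|[|m]]]; try by [].
rewrite (_ : 3`! = 6)%N // => e.
have -> : (6 * (16 * (4 * m.+3 * 'C(m.+3, 3))) = 64 * m.+3 * ('C(m.+3, 3) * 6))%N by lia.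
rewrite e (_ : m.+3.*2 = (2 * m).+4.+2)%N; last by lia.
rewrite /=; lia.
Qed.

Lemma crossing_number_excess p : (0 < n)%N -> rectilinear_drawing p ->
  (4 * (4 * crossing_number p))%N%:Z + (8 * (n * n.-1))%N%:Z =
  (2 * sum4 (fun a b c d => sep p a b c d))%N%:Z
  + \sum_x \sum_y excess p colour x y ^+ 2.
Proof.
move=> n_gt0 dp; have [p_inj p_gen] := dp.
rewrite (crossing_number_sum4 dp) -(excess_identity p_inj p_gen colour_sign sum_colour).
rewrite card_Knn; congr (_ + _).
by case: n n_gt0 => // k _; rewrite doubleS /= expr2; lia.
Qed.

Lemma crossing_number_ge p : (0 < n)%N -> rectilinear_drawing p ->
  (4 * n * 'C(n, 3) <= crossing_number p)%N.
Proof.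
move=> n_gt0 dp; have := crossing_number_excess n_gt0 dp.
have := sum4_sep_ge dp.1 dp.2; rewrite card_Knn.
have := binomial_identity.
have : 0 <= \sum_x \sum_y excess p colour x y ^+ 2.
  by do 2![apply: sumr_ge0 => ? _]; exact: sqr_ge0.
lia.
Qed.

Lemma alternating_crossing_number p : (0 < n)%N -> alternating_convex_drawing p ->
  crossing_number p = (4 * n * 'C(n, 3))%N.
Proof.
move=> n_gt0 [dp cvx alt]; have [p_inj p_gen] := dp.
have bal := convex_balanced p_inj p_gen cvx.
have edge x y : x != y -> (forall z, ori p x y z <= 0) -> colour x + colour y = 0.
  move=> xy le0; suff : is_black x != is_black y.
    by rewrite /colour; case: is_black; case: is_black.
  apply: alt; apply: supporting_hull_edge; [by exists x|by exists y| |].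
    by move/p_inj; exact/eqP.
  (* Genericity makes the inequality strict away from [x] and [y]. *)
  move=> _ [z _ <-] zx zy; rewrite lt_def le0 andbT eq_sym.
  by apply: ori_neq0 => //; apply/eqP => e; [apply: zx|apply: zy]; rewrite e.
have := crossing_number_excess n_gt0 dp.
rewrite big1 => [|x _]; last first.
  by rewrite big1 // => y _; rewrite (excess_eq0 p_inj p_gen sum_colour bal edge) expr0n.
have := sum4_sep_balanced p_inj p_gen bal; rewrite card_Knn.
have := binomial_identity; lia.
Qed.

(** * Alternating points on a parabola *)

Definition parabola_rank (u : Knn n) : nat :=
  match u with inl i => i.*2 | inr i => i.*2.+1 end.

Definition parabola_point (k : nat) : 'rV[R]_2 := \row_(j < 2) (k%:R ^+ j.+1).

(** Black vertices get the even abscissae and white ones the odd, so the colours alternate along the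
    parabola, and its two extreme points also differ in colour. *)
Definition parabola_drawing (u : Knn n) : 'rV[R]_2 := parabola_point (parabola_rank u).

Lemma parabola_point0 k : parabola_point k 0 0 = k%:R.
Proof. by rewrite mxE expr1. Qed.

Lemma parabola_point1 k : parabola_point k 0 1 = k%:R ^+ 2.
Proof. by rewrite mxE. Qed.

Lemma odd_parabola_rank u : odd (parabola_rank u) = ~~ is_black u.
Proof. by case: u => i /=; rewrite odd_double. Qed.

Lemma parabola_rank_inj : injective parabola_rank.
Proof.
move=> u v e; have := congr1 odd e; rewrite !odd_parabola_rank => /negb_inj.
by case: u v e => i [] j //= e _; congr (_ _); apply: val_inj => /=; lia.
Qed.

Lemma parabola_rank_surj k : (k < n.*2)%N -> exists u, parabola_rank u = k.
Proof.
move=> lt_k; have lt_k2 : (k./2 < n)%N by lia.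
have [ok|ek] := boolP (odd k).
  by exists (inr (Ordinal lt_k2)) => /=; lia.
by exists (inl (Ordinal lt_k2)) => /=; lia.
Qed.

Lemma parabola_rank_lt u : (parabola_rank u < n.*2)%N.
Proof. by case: u => i /=; have := ltn_ord i; lia. Qed.

(** A Vandermonde determinant. *)
Lemma orient_parabola i j k :
  orient (parabola_point i) (parabola_point j) (parabola_point k) =
  (j%:R - i%:R) * (k%:R - i%:R) * (k%:R - j%:R).
Proof. by rewrite /orient !parabola_point0 !parabola_point1; ring. Qed.

Lemma parabola_drawing_rectilinear : rectilinear_drawing parabola_drawing.
Proof.
have nat_inj (i j : nat) : i%:R = j%:R :> R -> i = j.
  by move/eqP; rewrite eqr_nat => /eqP.
split=> [u v /(congr1 (fun x : 'rV_2 => x 0 0))|].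
  by rewrite !parabola_point0 => /nat_inj/parabola_rank_inj.
split; first exact/finite_image/finite_finset.
move=> _ _ _ [u _ <-] [v _ <-] [w _ <-] uv uw vw [_ [[A [B [AB ->]]]]].
move=> [a _ ea] [b _ eb] [c _ ec].
have : orient (parabola_drawing u) (parabola_drawing v) (parabola_drawing w) = 0.
  by rewrite -ea -eb -ec /orient !mxE; ring.
rewrite orient_parabola => /eqP; rewrite !mulf_eq0 !subr_eq0 -orbA.
by case/or3P => /eqP/nat_inj/parabola_rank_inj e; [apply: uv|apply: uw|apply: vw];
  rewrite e.
Qed.

Lemma parabola_drawing_convex : convex_position (range parabola_drawing).
Proof.
move=> _ [u _ <-]; set r : R := (parabola_rank u)%:R.
(* The open half-plane above the tangent at [u]: at another point of the parabola the expression is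
   the square of the difference of abscissae. *)
pose D := [set X : 'rV[R]_2 | 0 < X 0 1 - 2 * r * X 0 0 + r ^+ 2].
have sub : hull (range parabola_drawing `\ parabola_drawing u) `<=` D.
  apply: hull_min => [X Y t t0 t1|_ [[v _ <-] vu]].
    have t1' : 0 < 1 - t by rewrite subr_gt0.
    rewrite /D /= !mxE => hX hY.
    have := mulr_gt0 t0 hX; have := mulr_gt0 t1' hY; lra.
  rewrite /D /= parabola_point0 parabola_point1.
  rewrite (_ : _ + _ = ((parabola_rank v)%:R - r) ^+ 2); last by ring.
  rewrite lt_def sqr_ge0 andbT sqrf_eq0 subr_eq0 eqr_nat; apply/eqP => e.
  by apply: vu; rewrite /= /parabola_drawing e.
move/sub; rewrite /D /= parabola_point0 parabola_point1 -/r.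
by rewrite (_ : _ + _ = 0) ?ltxx //; ring.
Qed.

(** Along the parabola the supporting functional minus [c] is a quadratic polynomial with zeros at
    the ends of the edge. For ends of equal colour there are points strictly between and strictly
    outside, which force its leading coefficient to be 0. *)
Lemma parabola_drawing_alternates : colours_alternate parabola_drawing.
Proof.
move=> u v [uv [a [c [a0 le_c eH]]]].
apply/eqP => same.
wlog lt_uv : u v uv eH same / (parabola_rank u < parabola_rank v)%N.
  move=> wl; have [lt|lt|/parabola_rank_inj e] := ltngtP (parabola_rank u) (parabola_rank v).
  - exact: (wl u v).
  - apply: (wl v u) => //; first by move=> e; apply: uv.
    by rewrite setUC.
  - by apply: uv; rewrite e.
have dot k : (parabola_point k *m a) 0 0 = k%:R * a 0 0 + k%:R ^+ 2 * a 1 0.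
  rewrite mxE !big_ord_recl big_ord0 addr0.
  rewrite (_ : lift ord0 ord0 = 1); last exact: val_inj.
  by rewrite (_ : ord0 = 0) // parabola_point0 parabola_point1.
have on w : w = u \/ w = v -> (parabola_drawing w *m a) 0 0 = c.
  move=> uvw; have : hull [set parabola_drawing u; parabola_drawing v] (parabola_drawing w).
    by apply: sub_hull; case: uvw => ->; [left|right].
  by rewrite eH => -[].
have eu := on u (or_introl erefl); have ev := on v (or_intror erefl).
have le k : (k < n.*2)%N -> k%:R * a 0 0 + k%:R ^+ 2 * a 1 0 <= c.
  move=> /parabola_rank_surj[w <-]; rewrite -dot; apply: le_c; apply: sub_hull.
  by exists w.
rewrite !dot in eu ev.
have par : odd (parabola_rank u) = odd (parabola_rank v).
  by rewrite !odd_parabola_rank same.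
have := parabola_rank_lt v.
move: (parabola_rank u) (parabola_rank v) lt_uv eu ev par => i j lt_ij ei ej par lt_j.
have ij : 0 < j%:R - i%:R :> R by rewrite subr_gt0 ltr_nat.
have a00 : a 0 0 = - (i%:R + j%:R) * a 1 0.
  apply: (mulfI (lt0r_neq0 ij)); move: ei ej; lra.
have fact k : k%:R * a 0 0 + k%:R ^+ 2 * a 1 0 - c = a 1 0 * ((k%:R - i%:R) * (k%:R - j%:R)).
  by rewrite -ei a00; ring.
have le0 k : (k < n.*2)%N -> a 1 0 * ((k%:R - i%:R) * (k%:R - j%:R)) <= 0.
  by move=> /le; rewrite -fact subr_le0.
have a1_ge0 : 0 <= a 1 0.
  (* Equal parity leaves room for a point between [i] and [j]. *)
  have lt_j1 : (i.+1 < j)%N by lia.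
  rewrite -(nmulr_lle0 (a 1 0) (_ : (i.+1%:R - i%:R) * (i.+1%:R - j%:R) < 0)) ?le0 //; first by lia.
  by rewrite pmulr_rlt0 ?subr_lt0 ?subr_gt0 ltr_nat.
have a1_le0 : a 1 0 <= 0.
  (* A point outside: if [i = 0] then [j] is even, so [j.+1 < n.*2]; otherwise 0 serves. *)
  have [i0|i0] := posnP i.
    rewrite -(pmulr_lle0 (a 1 0) (_ : 0 < (j.+1%:R - i%:R) * (j.+1%:R - j%:R))) ?le0 //; first by lia.
    by rewrite mulr_gt0 // subr_gt0 ltr_nat; lia.
  rewrite -(pmulr_lle0 (a 1 0) (_ : 0 < (0%:R - i%:R) * (0%:R - j%:R))) ?le0 //; first by lia.
  by rewrite !sub0r mulrNN mulr_gt0 // ltr0n; lia.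
have a10 : a 1 0 = 0 by apply/eqP; rewrite eq_le a1_ge0 a1_le0.
move/eqP: a0; apply; apply/colP => k; rewrite !mxE.
case: k => [[|[|//]] lt_k].
  by rewrite (_ : Ordinal lt_k = 0); [rewrite a00 a10 mulr0|apply: val_inj].
by rewrite (_ : Ordinal lt_k = 1); [rewrite a10|apply: val_inj].
Qed.

Lemma parabola_drawing_alternating_convex : alternating_convex_drawing parabola_drawing.
Proof.
split; [exact: parabola_drawing_rectilinear|exact: parabola_drawing_convex|].
exact: parabola_drawing_alternates.
Qed.

End Knn.

Theorem theorem1p1 (R : realType) (n : nat) (hn : (1 <= n)%N) :
  [/\ OCN R (Knn n) = (4 * n * 'C(n, 3))%N,
      (exists p : Knn n -> 'rV[R]_2, alternating_convex_drawing p) &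
      (forall p : Knn n -> 'rV[R]_2, alternating_convex_drawing p ->
         crossing_number p = (4 * n * 'C(n, 3))%N)].
Proof.
have ex := parabola_drawing_alternating_convex R n.
have attained := alternating_crossing_number hn ex.
split; [|by exists (@parabola_drawing R n)|by move=> p; exact: alternating_crossing_number].
rewrite /OCN; case: ex_minnP => k /asboolP[p [dp <-]] min.
apply/eqP; rewrite eqn_leq crossing_number_ge // andbT; apply: min.
by apply/asboolP; exists (@parabola_drawing R n); case: ex.
Qed.
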